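(* Let $l\ge0$ be an integer, and for $\eta\in\mathbb{R}^3$ let $u^l(\eta)=\frac{d}{d\epsilon}\big|_{\epsilon=0}U^l(\exp(\epsilon\hat\eta))\in\mathbb{R}^{(2l+1)\times(2l+1)}$, where $U^l$ is the real harmonics on $SO(3)$ defined in the context. Then for all $m,n\in\{-l,\dots,l\}$: $$u^l_{m,n}(e_1)=\begin{cases}\frac12(m+n)\sqrt{(l+|m|)(l-|m|+1)} & (m\ge2,\ n=-m+1)\text{ or }(m\le-2,\ n=-m-1),\\ -\frac12(m+n)\sqrt{(l-|m|)(l+|m|+1)} & (1\le m\le l-1,\ n=-m-1)\text{ or }(-l+1\le m\le-1,\ n=-m+1),\\ -\frac{1}{\sqrt2}\sqrt{l(l+1)} & m=-1,\ n=0,\\ \frac{1}{\sqrt2}\sqrt{l(l+1)} & m=0,\ n=-1,\\ 0&\text{otherwise},\end{cases}$$ $$u^l_{m,n}(e_2)=\begin{cases}\frac12\sqrt{(l+|m|)(l-|m|+1)} & (m\ge2,\ n=m-1)\text{ or }(m\le-2,\ n=m+1),\\ -\frac12\sqrt{(l-|m|)(l+|m|+1)} & (1\le m\le l-1,\ n=m+1)\text{ or }(-l+1\le m\le-1,\ n=m-1),\\ \frac{1}{\sqrt2}\sqrt{l(l+1)} & m=1,\ n=0,\\ -\frac{1}{\sqrt2}\sqrt{l(l+1)} & m=0,\ n=1,\\ 0&\text{otherwise},\end{cases}$$ $$u^l_{m,n}(e_3)=\begin{cases}-m & m=-n\text{ and }m\ne0,\\0&\text{otherwise.}\end{cases}$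$
   Context: All $(2l+1)\times(2l+1)$ matrices have rows and columns indexed by $m,n\in\{-l,\dots,l\}$ in ascending order. For $x\in\mathbb{R}^3$, $\hat x$ is the skew-symmetric $3\times3$ matrix with $\hat x y=x\times y$; $e_1,e_2,e_3$ is the standard basis of $\mathbb{R}^3$. Euler angles: $R(\alpha,\beta,\gamma)=\exp(\alpha\hat e_3)\exp(\beta\hat e_2)\exp(\gamma\hat e_3)$, with $\alpha,\gamma\in[0,2\pi)$, $\beta\in[0,\pi]$. Wigner matrices: $D^l:SO(3)\to\mathbb{C}^{(2l+1)\times(2l+1)}$ is the irreducible unitary representation (a homomorphism) $D^l_{m,n}(R(\alpha,\beta,\gamma))=e^{-im\alpha}d^l_{m,n}(\beta)e^{-in\gamma}$, where $d^l(\beta)$ is the real Wigner d-matrix; with the paper's convention $d^l(\beta)=\exp(\beta A^l)$, $A^l_{m,n}=-\tfrac12\sqrt{(l+m)(l-m+1)}\,\delta_{m-1,n}+\tfrac12\sqrt{(l-m)(l+m+1)}\,\delta_{m+1,n}$ (the standard Wigner d-matrix). Real harmonics: $U^l(R)=\overline{T^l}\,D^l(R)\,(T^l)^T$, which is a real orthogonal matrix and a homomorphism in $R$, where the unitary matrix $T^l$ is $$T^l_{m,n}=\begin{cases}1&m=n=0,\\0&|m|\ne|n|,\\ (-1)^m/\sqrt2&m>0,\ n=m,\\ 1/\sqrt2&m>0,\ n=-m,\\ i/\sqrt2&m<0,\ n=m,\\ -i(-1)^m/\sqrt2&m<0,\ n=-m.\end{cases}$$ *)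

(* Defs.v *)
From HB Require Import structures.
From mathcomp Require Import all_boot all_order all_algebra.
From mathcomp Require Import all_classical all_reals all_analysis.
From mathcomp Require Export complex.
Set Implicit Arguments.
Unset Strict Implicit.
Unset Printing Implicit Defensive.
Import Order.TTheory GRing.Theory Num.Theory.
Import numFieldNormedType.Exports.

Local Open Scope classical_set_scope.
Local Open Scope ring_scope.
Local Open Scope complex_scope.

(* The l.*2.+1 rows and columns carry the signed labels -l, ..., l. *)
Definition lab (l : nat) (i : 'I_(l.*2.+1)) : int := i%:Z - l%:Z.

Definition mexp (R : realType) (n : nat) (A : 'M[R]_n.+1) : 'M[R]_n.+1 :=
  limn (series (fun k : nat => (k`!%:R)^-1 *: A ^+ k)).

(* The matrix of y |-> x `cross` y; coordinates are numbered from 0. *)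
Definition hat (R : realType) (x : 'cV[R]_3) : 'M[R]_3 :=
  let x1 := x 0 0 in let x2 := x 1 0 in let x3 := x 2%:R 0 in
  \matrix_(i < 3, j < 3)
    nth 0 (nth [::] [:: [::   0; - x3;   x2];
                        [::  x3;    0; - x1];
                        [:: - x2;  x1;    0]] i) j.

(* basis_vec R 0, basis_vec R 1, basis_vec R 2%:R are e_1, e_2, e_3. *)
Definition basis_vec (R : realType) (k : 'I_3) : 'cV[R]_3 := delta_mx k 0.

Definition euler_rot (R : realType) (a b g : R) : 'M[R]_3 :=
  mexp (a *: hat (basis_vec R 2%:R)) *m mexp (b *: hat (basis_vec R 1))
  *m mexp (g *: hat (basis_vec R 2%:R)).

Definition euler_angles (R : realType) (Q : 'M[R]_3) : set (R * R * R) :=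
  [set t | [/\ 0 <= t.1.1 < 2 * pi, 0 <= t.1.2 <= pi, 0 <= t.2 < 2 * pi
             & euler_rot t.1.1 t.1.2 t.2 = Q]].

Definition wigner_gen (R : realType) (l : nat) : 'M[R]_(l.*2.+1) :=
  \matrix_(i, j) let m := lab i in let n := lab j in
    - (1 / 2) * Num.sqrt (((l%:Z + m) * (l%:Z - m + 1))%:~R)
      * (m - 1 == n)%:R
    + 1 / 2 * Num.sqrt (((l%:Z - m) * (l%:Z + m + 1))%:~R)
      * (m + 1 == n)%:R.

Definition wigner_d (R : realType) (l : nat) (b : R) : 'M[R]_(l.*2.+1) :=
  mexp (b *: wigner_gen R l).

Definition expi (R : realType) (t : R) : R[i] := cos t +i* sin t.

Definition wigner_euler (R : realType) (l : nat) (a b g : R) :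
    'M[R[i]]_(l.*2.+1) :=
  \matrix_(i, j) (expi (- ((lab i)%:~R * a)) * (wigner_d l b i j)%:C
                  * expi (- ((lab j)%:~R * g))).

(* D^l as a function of the rotation matrix Q, through a choice of Euler
   angles of Q.  Every Q in SO(3) has Euler angles, and although they are not
   unique when b = 0 or b = pi, [wigner_euler] takes the same value on all of
   them.  Outside SO(3) the value is a dummy one. *)
Definition wigner_D (R : realType) (l : nat) (Q : 'M[R]_3) :
    'M[R[i]]_(l.*2.+1) :=
  let t := xget (0, 0, 0) (euler_angles Q) in wigner_euler l t.1.1 t.1.2 t.2.

Definition T_mx (R : realType) (l : nat) : 'M[R[i]]_(l.*2.+1) :=
  \matrix_(i, j) let m := lab i in let n := lab j in
    if (m == 0) && (n == 0) then 1
    else if `|m| != `|n| then 0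
    else if 0 < m then
      if n == m then ((-1) ^ m / Num.sqrt 2)%:C else (1 / Num.sqrt 2)%:C
    else
      if n == m then 'i * (1 / Num.sqrt 2)%:C
      else - 'i * ((-1) ^ m / Num.sqrt 2)%:C.

Definition real_harm (R : realType) (l : nat) (Q : 'M[R]_3) :
    'M[R[i]]_(l.*2.+1) :=
  map_mx conjc (T_mx R l) *m wigner_D l Q *m (T_mx R l)^T.

(* R[i] is not equipped with a normed R-module structure, so the derivative of
   a complex matrix function of a real variable is taken on the real and
   imaginary parts. *)
Definition cmx_derivable (R : realType) (p q : nat)
    (F : R -> 'M[R[i]]_(p, q)) (t : R) : Prop :=
  derivable (fun s => map_mx (@complex.Re R) (F s)) t 1 /\
  derivable (fun s => map_mx (@complex.Im R) (F s)) t 1.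

Definition cmx_derive (R : realType) (p q : nat)
    (F : R -> 'M[R[i]]_(p, q)) (t : R) : 'M[R[i]]_(p, q) :=
  map2_mx (fun x y => x +i* y)
    ('D_1 (fun s => map_mx (@complex.Re R) (F s)) t)
    ('D_1 (fun s => map_mx (@complex.Im R) (F s)) t).

Definition harm_curve (R : realType) (l : nat) (eta : 'cV[R]_3) (eps : R) :
    'M[R[i]]_(l.*2.+1) :=
  real_harm l (mexp (eps *: hat eta)).

Definition harm_gen (R : realType) (l : nat) (eta : 'cV[R]_3) :
    'M[R[i]]_(l.*2.+1) :=
  cmx_derive (harm_curve l eta) 0.

(* Main.v *)
Require Import Defs.
From HB Require Import structures.
From mathcomp Require Import all_boot all_order all_algebra.
From mathcomp Require Import all_classical all_reals all_analysis.
From mathcomp Require Import ring lra zify.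
Set Implicit Arguments.
Unset Strict Implicit.
Unset Printing Implicit Defensive.
Import Order.TTheory GRing.Theory Num.Theory.
Import numFieldNormedType.Exports.

(** Near 0, each of the three curves is a family of Euler rotations with explicit
    angles: writing R(a, b, g) for the rotation with Euler angles a, b, g,
    exp(s e_1) = R(-pi/2, s, pi/2), exp(s e_2) = R(0, s, 0) and
    exp(s e_3) = R(s, 0, 0).  On such families D^l is explicit, and its
    derivative at s = 0 comes from that of exp(s A^l), which is A^l, or from
    that of the phases.

    The obstacle is that these angles leave the standard ranges, already when
    s < 0, so they are not the ones through which D^l is defined.
    [wigner_D_euler_rot] removes it: D^l of R(a, b, g) is given by the
    Euler-angle formula for all real a, g and all |b| < pi.  Two facts carry
    it.  First, Rodrigues' formula [mexp_rodrigues] makes the rotation matrices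
    explicit, so that the cosines and sines that the rotation determines can be
    read off ([wigner_euler_unique]).  Second, the change of parameters
    (a, b, g) to (a + pi, -b, g + pi), which fixes the rotation, also fixes the
    Wigner matrix ([wigner_euler_flip]), because A^l changes sign under
    conjugation by the diagonal matrix with entries (-1)^m.

    It remains to conjugate the three derivatives by T^l.  Every row of T^l has
    at most two nonzero entries, and each derivative W satisfies
    W(-m, -n) = (-1)^(m+n) conj W(m, n); hence every entry in the new basis is a
    combination of real or imaginary parts of W(m, n) and W(m, -n)
    ([to_real_basis_real]).  As W is real for e_2 and imaginary for e_1 and e_3,
    and is supported on |m - n| = 1 or on m = n, the stated formulas follow by
    comparing the signs of m and n. *)

Local Open Scope ring_scope.
Local Open Scope complex_scope.

(** * Matrix exponentials *)

Lemma cvg_mx_coord (R : realType) (m n : nat) (u : nat -> 'M[R]_(m, n))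
    (M : 'M[R]_(m, n)) :
  (forall i j, (fun k => u k i j) @ \oo --> M i j)%classic ->
  (u @ \oo --> M)%classic.
Proof.
move=> uM; apply/cvg_mx_entourageP => A entA.
have : (\forall k \near \oo, forall ij, A (M ij.1 ij.2, u k ij.1 ij.2))%classic.
  apply: filter_forall => -[i j] /=.
  by have /cvg_entourageP/(_ A entA) := uM i j.
by apply: filterS => k uA i j; rewrite inE; exact: (uA (i, j)).
Qed.

(** The maximum norm on matrices is not submultiplicative, but the sum of all
    absolute entries dominates every absolute row sum, so its powers bound
    the entries of the powers of [A]. *)
Lemma mx_expr_coord_le (R : realType) (n : nat) (A : 'M[R]_n.+1) (k : nat) i j :
  `|(A ^+ k) i j| <= (\sum_p \sum_q `|A p q|) ^+ k.
Proof.
elim: k i => [|k IHk] i.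
  by rewrite expr0 expr0 mxE; case: (i == j); rewrite ?normr1 ?normr0.
rewrite !exprS mxE (le_trans (ler_norm_sum _ _ _))//.
apply: (@le_trans _ _ (\sum_q `|A i q| * (\sum_p \sum_q `|A p q|) ^+ k)).
  by apply: ler_sum => q _; rewrite normrM ler_wpM2l.
rewrite -mulr_suml ler_wpM2r ?exprn_ge0 ?sumr_ge0 //.
  by move=> p _; apply: sumr_ge0.
rewrite [leRHS](bigD1 i) //= lerDl sumr_ge0 // => p _.
exact: sumr_ge0.
Qed.

(** The shift [p] is there because differentiating the series of
    [mexp (b *: A) i j] in [b] only replaces [A ^+ k] by [A ^+ k.+1]: one
    statement covers the series and its two formal derivatives. *)
Lemma is_cvg_pseries_expr (R : realType) (n : nat) (A : 'M[R]_n.+1) (p : nat)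
    i j (x : R) :
  cvgn (pseries (fun k => (k`!%:R)^-1 * (A ^+ (k + p)) i j) x).
Proof.
set c := \sum_p \sum_q `|A p q|.
apply: normed_cvg; rewrite /normed_series_of /=.
apply: (@series_le_cvg _ _ (fun k => c ^+ p * exp_coeff (c * `|x|) k)).
- by move=> k; exact: normr_ge0.
- have c0 : 0 <= c by apply: sumr_ge0 => q _; apply: sumr_ge0.
  by move=> k; rewrite mulr_ge0 ?exprn_ge0 // exp_coeff_ge0 // mulr_ge0.
- move=> k; rewrite /exp_coeff /= !normrM normfV normr_nat normrX exprMn.
  have -> : c ^+ p * (c ^+ k * `|x| ^+ k / k`!%:R)
          = k`!%:R^-1 * c ^+ (k + p) * `|x| ^+ k by rewrite exprD; ring.
  by rewrite ler_wpM2r ?exprn_ge0// ler_wpM2l ?invr_ge0 // mx_expr_coord_le.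
exact: is_cvg_seriesZ (is_cvg_series_exp_coeff (c * `|x|)).
Qed.

(** Entries of [b |-> exp (b A)] are scalar power series, to which the
    theory of term-by-term differentiation applies. *)
Lemma mexp_coord (R : realType) (n : nat) (A : 'M[R]_n.+1) (b : R) i j :
  mexp (b *: A) i j = limn (pseries (fun k => (k`!%:R)^-1 * (A ^+ k) i j) b).
Proof.
pose f i j k := (k`!%:R)^-1 * (A ^+ k) i j.
rewrite /mexp.
suff -> : limn (series (fun k => (k`!%:R)^-1 *: (b *: A) ^+ k))
        = \matrix_(i, j) limn (pseries (f i j) b) by rewrite mxE.
apply/cvg_lim; first exact: norm_hausdorff.
apply: cvg_mx_coord => {}i {}j; rewrite mxE.
rewrite (_ : (fun k => _) = pseries (f i j) b).
  have := @is_cvg_pseries_expr R n A 0 i j b.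
  under [X in pseries X]funext do rewrite addn0.
  exact.
apply/funext => k; rewrite /pseries /series /= summxE.
apply: eq_bigr => q _.
by rewrite exprZn !mxE /f; ring.
Qed.

Lemma lim_pseries0 (R : realType) (f : nat -> R) : limn (pseries f 0) = f 0%N.
Proof.
apply: lim_near_cst => //; near=> m.
rewrite -[m]prednK; last by near: m; exists 1%N.
rewrite /pseries /series /= big_nat_recl //= mulr1 big1 ?addr0 // => i _.
by rewrite expr0n mulr0.
Unshelve. all: by end_near. Qed.

Lemma mexp0 (R : realType) (n : nat) (A : 'M[R]_n.+1) : mexp (0 *: A) = 1.
Proof.
by apply/matrixP => i j; rewrite mexp_coord lim_pseries0 invr1 mul1r.
Qed.

Lemma is_derive_mexp0 (R : realType) (n : nat) (A : 'M[R]_n.+1) i j :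
  is_derive (0 : R) (1 : R) (fun b => mexp (b *: A) i j) (A i j).
Proof.
pose f p k := (k`!%:R)^-1 * (A ^+ (k + p)) i j.
have df p : pseries_diffs (f p) = f p.+1.
  apply/funext => k; rewrite /pseries_diffs /f factS natrM invfM addSnnS.
  by rewrite mulrA mulVKf // pnatr_eq0.
have -> : (fun b => mexp (b *: A) i j) = fun b => limn (pseries (f 0%N) b).
  apply/funext => b; rewrite mexp_coord; congr (limn (pseries _ b)).
  by apply/funext => k; rewrite /f addn0.
have := @pseries_snd_diffs R (f 0%N) 1 0; rewrite !df lim_pseries0.
have -> : f 1%N 0%N = A i j by rewrite /f invr1 mul1r expr1.
by apply; rewrite ?normr0 ?normr1 ?ltr01 //; exact: is_cvg_pseries_expr.
Qed.

(** If conjugation by the diagonal matrix of signs [d] negates [A], then it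
    multiplies the [k]-th power of [A] by [(-1) ^+ k], that is, it turns the
    exponential series at [b] into the one at [- b]. *)
Lemma mexp_sign (R : realType) (n : nat) (A : 'M[R]_n.+1) (d : 'I_n.+1 -> R)
    (b : R) :
  (forall i, d i ^+ 2 = 1) -> (forall i j, d i * A i j * d j = - A i j) ->
  forall i j, mexp (- b *: A) i j = d i * mexp (b *: A) i j * d j.
Proof.
move=> d2 dA i j.
have dAk k p q : d p * (A ^+ k) p q * d q = (-1) ^+ k * (A ^+ k) p q.
  elim: k p => [|k IHk] p.
    rewrite !expr0 mul1r !mxE; case: eqP => [<-|_]; rewrite ?mulr1 ?mulr0 ?mul0r//.
    by rewrite -expr2 d2.
  rewrite exprS mxE mulr_sumr mulr_suml exprS mulr_sumr; apply: eq_bigr => r _.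
  have -> : d p * (A p r * (A ^+ k) r q) * d q
     = d p * A p r * ((d r) ^+ 2 * (A ^+ k) r q * d q) by rewrite d2; ring.
  have -> : d p * A p r * ((d r) ^+ 2 * (A ^+ k) r q * d q)
     = (d p * A p r * d r) * (d r * (A ^+ k) r q * d q) by ring.
  by rewrite dA IHk; ring.
rewrite !mexp_coord.
set f := fun k => _.
have cf : cvgn (pseries f b).
  have := @is_cvg_pseries_expr R n A 0 i j b.
  by under [X in pseries X]funext do rewrite addn0.
have -> : pseries f (- b) = (fun k => d i * d j * pseries f b k).
  apply/funext => k; rewrite /pseries /series /= mulr_sumr.
  apply: eq_bigr => q _; rewrite exprNn /f.
  transitivity (q`!%:R^-1 * b ^+ q * ((-1) ^+ q * (A ^+ q) i j)); first by ring.
  by rewrite -dAk; ring.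
transitivity (d i * d j * limn (pseries f b)); last by ring.
by apply/cvg_lim => //; apply: cvgMl_tmp.
Qed.

(** From [H ^+ 3 = - H], the odd powers of [H] are [H] and the positive even
    ones [H ^+ 2], up to alternating signs; hence the exponential series
    splits into the series of sine and cosine, except for its constant term. *)
Lemma mexp_rodrigues (R : realType) (n : nat) (H : 'M[R]_n.+1) (x : R) :
  H ^+ 3 = - H ->
  mexp (x *: H) = 1 + sin x *: H + (1 - cos x) *: H ^+ 2.
Proof.
move=> H3.
have Hodd k : H ^+ (k.*2.+1) = (-1) ^+ k *: H.
  elim: k => [|k IHk]; first by rewrite expr0 scale1r.
  by rewrite doubleS -addn2 exprD IHk -scalerAl -exprS H3 exprS mulN1r scaleNr scalerN.
have Heven k : H ^+ (k.*2.+2) = (-1) ^+ k *: H ^+ 2.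
  by rewrite exprSr Hodd -scalerAl expr2.
apply/cvg_lim; first exact: norm_hausdorff.
have -> : 1 + sin x *: H + (1 - cos x) *: H ^+ 2
        = (sin x *: H - cos x *: H ^+ 2) + (1 + H ^+ 2).
  by rewrite scalerBl scale1r addrACA [RHS]addrC addrACA; congr (_ + _); rewrite addrC.
suff -> : series (fun k => (k`!%:R)^-1 *: (x *: H) ^+ k)
   = (fun n => (series (sin_coeff x) n *: H - series (cos_coeff x) n *: H ^+ 2)
               + (0 < n)%:R *: (1 + H ^+ 2)).
  apply: cvgD.
    by apply: cvgB; apply: cvgZr_tmp; rewrite unlock;
      [exact: is_cvg_series_sin_coeff|exact: is_cvg_series_cos_coeff].
  apply: cvg_near_cst; near=> m.
  have -> : (0 < m)%N by near: m; exists 1%N.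
  by rewrite scale1r.
have term k : (k`!%:R)^-1 *: (x *: H) ^+ k =
    sin_coeff x k *: H - cos_coeff x k *: H ^+ 2 + (k == 0)%:R *: (1 + H ^+ 2).
  rewrite exprZn scalerA /sin_coeff /cos_coeff /=.
  have [kodd|keven] := boolP (odd k).
    have -> : k = (k.-1)./2.*2.+1 by lia.
    rewrite Hodd scalerA /= doubleK !mul0r !scale0r subr0 addr0.
    by congr (_ *: _); ring.
  have [->|k0] := eqVneq k 0%N.
    rewrite !mulr0n !mul0r scale0r sub0r !expr0 /= divr1 !mulr1 !scale1r.
    by rewrite fact0 invr1 scale1r addrCA addNr addr0.
  have -> : k = (k./2).-1.*2.+2 by lia.
  rewrite Heven scalerA !mulr0n !mul0r !scale0r sub0r addr0 -scaleNr /=.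
  by rewrite doubleK -exprnP (exprS (-1)); congr (_ *: _); ring.
apply/funext => m; rewrite /series /=.
elim: m => [|m IHm].
  by rewrite !big_geq// !scale0r subr0 addr0.
rewrite !big_nat_recr //= IHm term !scalerDl opprD.
rewrite addrACA [X in X + _ = _]addrACA; congr (_ + _).
by rewrite -scalerDl; case: (m) => [|k]; rewrite ?add0r ?addr0.
Unshelve. all: by end_near. Qed.

(** * Euler rotations and phases *)

Definition mx3 (R : realType) (a b c d e f g h k : R) : 'M[R]_3 :=
  \matrix_(i < 3, j < 3)
    nth 0 (nth [::] [:: [:: a; b; c]; [:: d; e; f]; [:: g; h; k]] i) j.

Lemma ord3P (k : 'I_3) : [\/ k = 0, k = 1 | k = 2%:R].
Proof.
by case: k => [[|[|[|//]]] ?]; [apply: Or31|apply: Or32|apply: Or33]; exact: val_inj.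
Qed.

Lemma mx3P (R : realType) (A B : 'M[R]_3) :
  A 0 0 = B 0 0 -> A 0 1 = B 0 1 -> A 0 2%:R = B 0 2%:R ->
  A 1 0 = B 1 0 -> A 1 1 = B 1 1 -> A 1 2%:R = B 1 2%:R ->
  A 2%:R 0 = B 2%:R 0 -> A 2%:R 1 = B 2%:R 1 -> A 2%:R 2%:R = B 2%:R 2%:R ->
  A = B.
Proof.
move=> *; apply/matrixP => i j.
by case: (ord3P i) => ->; case: (ord3P j) => ->.
Qed.

Lemma mulmx3 (R : realType) (a b c d e f g h k a' b' c' d' e' f' g' h' k' : R) :
  mx3 a b c d e f g h k *m mx3 a' b' c' d' e' f' g' h' k' =
  mx3 (a * a' + b * d' + c * g') (a * b' + b * e' + c * h') (a * c' + b * f' + c * k')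
      (d * a' + e * d' + f * g') (d * b' + e * e' + f * h') (d * c' + e * f' + f * k')
      (g * a' + h * d' + k * g') (g * b' + h * e' + k * h') (g * c' + h * f' + k * k').
Proof.
by apply: mx3P; rewrite !mxE !big_ord_recl big_ord0 !mxE /= addr0 addrA.
Qed.

Lemma mexp_hat (R : realType) (x : 'cV[R]_3) (t : R) :
  x 0 0 ^+ 2 + x 1 0 ^+ 2 + x 2%:R 0 ^+ 2 = 1 ->
  mexp (t *: hat x) = 1 + sin t *: hat x + (1 - cos t) *: (hat x *m hat x).
Proof.
move=> x1; rewrite mexp_rodrigues ?expr2 //.
have hatE : hat x = mx3 0 (- x 2%:R 0) (x 1 0) (x 2%:R 0) 0 (- x 0 0)
                        (- x 1 0) (x 0 0) 0 by [].
rewrite !exprS expr0 mulr1 -!mulmxE hatE !mulmx3.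
move: x1; move: (x 0 0) (x 1 0) (x 2%:R 0) => a b c x1.
(* The entries of the cube are those of [- hat x] times the squared norm. *)
by apply: mx3P; rewrite !mxE /= -[RHS]mulr1 -x1; ring.
Qed.

Section Rotations.
Variable R : realType.
Implicit Types a b g t : R.

Lemma rot1E t : mexp (t *: hat (basis_vec R 0)) =
  mx3 1 0 0  0 (cos t) (- sin t)  0 (sin t) (cos t).
Proof.
rewrite mexp_hat; last by rewrite !mxE /=; ring.
by apply: mx3P; rewrite !mxE !big_ord_recl big_ord0 !mxE /=; ring.
Qed.

Lemma rot2E t : mexp (t *: hat (basis_vec R 1)) =
  mx3 (cos t) 0 (sin t)  0 1 0  (- sin t) 0 (cos t).
Proof.
rewrite mexp_hat; last by rewrite !mxE /=; ring.
by apply: mx3P; rewrite !mxE !big_ord_recl big_ord0 !mxE /=; ring.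
Qed.

Lemma rot3E t : mexp (t *: hat (basis_vec R 2%:R)) =
  mx3 (cos t) (- sin t) 0  (sin t) (cos t) 0  0 0 1.
Proof.
rewrite mexp_hat; last by rewrite !mxE /=; ring.
by apply: mx3P; rewrite !mxE !big_ord_recl big_ord0 !mxE /=; ring.
Qed.

Lemma euler_rotE a b g : euler_rot a b g =
  mx3 (cos a * cos b * cos g - sin a * sin g)
      (- (cos a * cos b * sin g) - sin a * cos g) (cos a * sin b)
      (sin a * cos b * cos g + cos a * sin g)
      (- (sin a * cos b * sin g) + cos a * cos g) (sin a * sin b)
      (- (sin b * cos g)) (sin b * sin g) (cos b).
Proof.
rewrite /euler_rot rot2E !rot3E !mulmx3.
by apply: mx3P; rewrite !mxE /=; ring.
Qed.

(** The angle is [acos (cos a)] or its reflection, according to the sign of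
    the sine. *)
Lemma polar_angle a :
  exists2 a', 0 <= a' < 2 * pi & cos a' = cos a /\ sin a' = sin a.
Proof.
have cosa : -1 <= cos a <= 1 by rewrite cos_geN1 cos_le1.
have p0 := acos_ge0 cosa; have pp := acos_lepi cosa; have pi0 := @pi_gt0 R.
have sa : sin (acos (cos a)) = `|sin a|.
  by rewrite sin_acos // -sin2cos2 sqrtr_sqr.
have ca : cos (acos (cos a)) = cos a by rewrite acosK // in_itv.
have [s0|s0] := leP 0 (sin a).
  exists (acos (cos a)); first by apply/andP; split=> //; lra.
  by rewrite sa ca ger0_norm.
exists (2 * pi - acos (cos a)).
  suff : acos (cos a) != 0 by move=> ?; apply/andP; split; lra.
  apply/eqP => a0; move: sa; rewrite a0 sin0 ltr0_norm // => ?; lra.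
rewrite mulrC mulr_natr addrC cosD2pi sinD2pi cosN sinN ca sa ltr0_norm ?opprK//.
Qed.

Lemma expiD a b : expi (a + b) = expi a * expi b :> R[i].
Proof. by rewrite /expi cosD sinD; simpc; rewrite [sin a * _ + _]addrC. Qed.

Lemma expi_eq a b : cos a = cos b -> sin a = sin b -> expi a = expi b.
Proof. by rewrite /expi => -> ->. Qed.

Lemma expi0 : expi 0 = 1 :> R[i].
Proof. by rewrite /expi cos0 sin0. Qed.

Lemma expi_neq0 a : expi a != 0.
Proof.
apply/eqP => a0; have : expi (a + - a) = 1 by rewrite subrr expi0.
by rewrite expiD a0 mul0r => /eqP; rewrite eq_sym oner_eq0.
Qed.

Lemma expiN a : expi (- a) = (expi a)^-1.
Proof.
apply: (mulfI (expi_neq0 a)).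
by rewrite -expiD subrr expi0 mulfV ?expi_neq0.
Qed.

Lemma expiX (k : int) a : expi (k%:~R * a) = expi a ^ k.
Proof.
have expiXn (n : nat) : expi (n%:R * a) = expi a ^+ n.
  elim: n => [|n IHn]; first by rewrite mul0r expi0.
  by rewrite -natr1 mulrDl mul1r expiD IHn exprSr.
case: k => n; first by rewrite -exprnP -expiXn.
by rewrite NegzE rmorphN /= mulNr expiN -exprnN -expiXn.
Qed.

Lemma expipi : expi pi = -1 :> R[i].
Proof. by rewrite /expi cospi sinpi; apply/eqP; rewrite eq_complex /= oppr0 !eqxx. Qed.

End Rotations.

(** * The Wigner matrix of an arbitrary Euler rotation *)

Section WignerOnSO3.
Variables (R : realType) (l : nat).
Implicit Types a b g t : R.

(** The parity sign of the label, which also appears in [T_mx]. *)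
Definition lab_sign (i : 'I_(l.*2.+1)) : R := (-1) ^ lab i.

Lemma lab_sign_sqr i : lab_sign i ^+ 2 = 1.
Proof. by rewrite expr2 -expfzMl mulN1r opprK exp1rz. Qed.

Lemma lab_sign_add1 i j : lab i = lab j + 1 -> lab_sign i = - lab_sign j.
Proof. by rewrite /lab_sign => ->; rewrite expfzDr ?oppr_eq0 ?oner_eq0 // expr1z mulrN1. Qed.

(** The generator only links labels of opposite parity. *)
Lemma wigner_gen_sign i j :
  lab_sign i * wigner_gen R l i j * lab_sign j = - wigner_gen R l i j.
Proof.
have sq := lab_sign_sqr.
rewrite mxE /=; have [ij|_] := eqVneq (lab i - 1) (lab j).
  have /negPf -> : lab i + 1 != lab j by apply/eqP; lia.
  have /lab_sign_add1 -> : lab i = lab j + 1 by lia.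
  by ring: (sq j).
have [ij|_] := eqVneq (lab i + 1) (lab j); last by rewrite !mulr0 addr0 mulr0 mul0r oppr0.
have /lab_sign_add1 -> : lab j = lab i + 1 by lia.
by ring: (sq i).
Qed.

Lemma wigner_dN b i j :
  wigner_d l (- b) i j = lab_sign i * wigner_d l b i j * lab_sign j.
Proof. exact: (mexp_sign b lab_sign_sqr wigner_gen_sign). Qed.

(** The phases depend on the angles only through [expi a] and [expi g], which
    are what a rotation matrix determines. *)
Lemma wigner_eulerE a b g i j : wigner_euler l a b g i j =
  expi a ^ (- lab i) * (wigner_d l b i j)%:C * expi g ^ (- lab j).
Proof. by rewrite mxE -!mulNr -!rmorphN /= !expiX. Qed.

(** The parameters (a, b, g) and (a + pi, -b, g + pi) give the same rotation.
    On the Wigner side, the two phases contribute the signs of the row and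
    the column, which undo the effect of [b |-> - b] in [wigner_dN]. *)
Lemma wigner_euler_flip a b g :
  wigner_euler l (a + pi) (- b) (g + pi) = wigner_euler l a b g.
Proof.
apply/matrixP => i j; rewrite !wigner_eulerE (expiD a pi) (expiD g pi) expipi.
rewrite !expfzMl wigner_dN.
have sgC k : (-1) ^ (- lab k) = (lab_sign k)%:C :> R[i].
  by rewrite fmorphXz rmorphN1 -exprz_inv invrN1.
rewrite !sgC !rmorphM /=.
have sq k : (lab_sign k)%:C ^+ 2 = 1 :> R[i] by rewrite -rmorphXn lab_sign_sqr.
(* Over an abstract ring, so that complex multiplication is not unfolded. *)
have signs_cancel (C : comPzRingType) (x y z d w : C) :
    x ^+ 2 = 1 -> y ^+ 2 = 1 -> z * x * (x * d * y) * (w * y) = z * d * w.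
  move=> x2 y2; transitivity (x ^+ 2 * y ^+ 2 * (z * d * w)); first by ring.
  by rewrite x2 y2 !mul1r.
exact: signs_cancel (sq i) (sq j).
Qed.

Lemma euler_rot_flip a b g : euler_rot (a + pi) (- b) (g + pi) = euler_rot a b g.
Proof.
rewrite !euler_rotE !cosDpi !sinDpi cosN sinN.
by apply: mx3P; rewrite !mxE /=; ring.
Qed.

Lemma wigner_d0 : wigner_d l 0 = 1 :> 'M[R]__.
Proof. exact: mexp0. Qed.

(** At b = 0 only the sum of the other two angles is visible, as it is in
    the rotation matrix. *)
Lemma wigner_euler_b0 a g i j :
  wigner_euler l a 0 g i j = expi (a + g) ^ (- lab i) * (i == j)%:R.
Proof.
rewrite wigner_eulerE wigner_d0 mxE expiD expfzMl.
case: eqP => [<-|_]; first by rewrite rmorph1 !mulr1.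
by rewrite rmorph0 !(mulr0, mul0r).
Qed.

(** A rotation determines the Wigner matrix although it does not determine
    its Euler angles.  By the flip one may take b0 >= 0; the last diagonal
    entry of the rotation then gives b = b0.  If b = 0, the rotation
    determines the phase of the sum of the two other angles; otherwise
    sin b > 0 and the last column and the last row give both phases. *)
Lemma wigner_euler_unique a b g a0 b0 g0 :
    0 <= b <= pi -> `|b0| < pi -> euler_rot a b g = euler_rot a0 b0 g0 ->
  wigner_euler l a b g = wigner_euler l a0 b0 g0.
Proof.
move=> b_pi.
wlog b0_ge0 : a0 b0 g0 / 0 <= b0 => [th|].
  have [b0_ge0|b0_lt0] := leP 0 b0; first exact: th.
  rewrite -(euler_rot_flip a0) -(wigner_euler_flip a0) -normrN; apply: th.
  by rewrite oppr_ge0 ltW.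
rewrite ger0_norm // => b0_pi /[!euler_rotE] /matrixP eR.
have := eR 2%:R 2%:R; rewrite !mxE /= => /cos_inj.
rewrite !in_itv /= b_pi b0_ge0 ltW //= => /(_ isT isT) bb0; subst b0.
have [b0|b_neq0] := eqVneq b 0.
  have e0 := eR 0 0; have e1 := eR 1 0; move: e0 e1; rewrite !mxE /= b0 cos0 !mulr1 => e0 e1.
  apply/matrixP => i j; rewrite (wigner_euler_b0 a) (wigner_euler_b0 a0).
  suff -> : expi (a + g) = expi (a0 + g0) by [].
  by apply: expi_eq; rewrite ?cosD ?sinD // addrC e1 addrC.
have sb : sin b != 0 by rewrite gt_eqF // sin_gt0_pi // b0_pi lt_def b_neq0 b0_ge0.
have /= ca := eR 0 2%:R; have sa := eR 1 2%:R.
have cg := eR 2%:R 0; have sg := eR 2%:R 1.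
move: ca sa cg sg; rewrite !mxE /=.
move=> /(mulIf sb) ca /(mulIf sb) sa /oppr_inj /(mulfI sb) cg /(mulfI sb) sg.
apply/matrixP => i j; rewrite !wigner_eulerE.
by rewrite (expi_eq ca sa) (expi_eq cg sg).
Qed.

Lemma euler_angles_ex a b g : `|b| < pi -> (euler_angles (euler_rot a b g) !=set0)%classic.
Proof.
wlog b_ge0 : a b g / 0 <= b => [th|].
  have [b_ge0|b_lt0] := leP 0 b; first exact: th.
  by rewrite -euler_rot_flip -normrN; apply: th; rewrite oppr_ge0 ltW.
rewrite ger0_norm // => b_pi.
have [a' a'_itv [ca sa]] := polar_angle a.
have [g' g'_itv [cg sg]] := polar_angle g.
exists (a', b, g'); split; rewrite //= ?b_ge0 ?ltW //.
by rewrite !euler_rotE ca sa cg sg.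
Qed.

(** The representation is given by the Euler-angle formula even for angles
    outside their standard ranges.  This gives a single formula along a curve
    through the identity, where the standard angles jump. *)
Lemma wigner_D_euler_rot a b g : `|b| < pi ->
  wigner_D l (euler_rot a b g) = wigner_euler l a b g.
Proof.
move=> b_pi; rewrite /wigner_D.
have /(xgetPex (0, 0, 0)) [_ b'_pi _ eQ] := euler_angles_ex a g b_pi.
exact: wigner_euler_unique b'_pi b_pi eQ.
Qed.

End WignerOnSO3.

(** * Derivatives of complex matrix functions *)

Section ComplexDerivative.
Variable R : realType.
Implicit Types (t : R) (f g : R -> R[i]).

(** Taken on real and imaginary parts, to match [cmx_derive]. *)
Definition is_cderive f t (df : R[i]) :=
  is_derive t (1 : R) (fun s => complex.Re (f s)) (complex.Re df) /\
  is_derive t (1 : R) (fun s => complex.Im (f s)) (complex.Im df).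

Lemma is_cderiveD f g t df dg :
  is_cderive f t df -> is_cderive g t dg -> is_cderive (fun s => f s + g s) t (df + dg).
Proof.
move=> [fr fi] [gr gi]; split.
  have -> : (fun s => complex.Re (f s + g s))
          = (fun s => complex.Re (f s)) + (fun s => complex.Re (g s)).
    by apply/funext => s /=; rewrite fctE raddfD.
  by rewrite raddfD; exact: is_deriveD.
have -> : (fun s => complex.Im (f s + g s))
        = (fun s => complex.Im (f s)) + (fun s => complex.Im (g s)).
  by apply/funext => s /=; rewrite fctE raddfD.
by rewrite raddfD; exact: is_deriveD.
Qed.

Lemma is_cderiveMl c f t df : is_cderive f t df -> is_cderive (fun s => c * f s) t (c * df).
Proof.
case: c df => [a b] [u v] [/= fr fi]; split => /=.
  have -> : (fun s => complex.Re ((a +i* b) * f s))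
          = a \*: (fun s => complex.Re (f s)) - b \*: (fun s => complex.Im (f s)).
    apply/funext => s; rewrite -[RHS]/(a * complex.Re (f s) - b * complex.Im (f s)).
    by case: (f s).
  by apply: is_deriveB; exact: is_deriveZ.
have -> : (fun s => complex.Im ((a +i* b) * f s))
        = a \*: (fun s => complex.Im (f s)) + b \*: (fun s => complex.Re (f s)).
  apply/funext => s; rewrite -[RHS]/(a * complex.Im (f s) + b * complex.Re (f s)).
  by case: (f s).
by apply: is_deriveD; exact: is_deriveZ.
Qed.

Lemma is_cderiveMr c f t df : is_cderive f t df -> is_cderive (fun s => f s * c) t (df * c).
Proof.
by move=> /(is_cderiveMl c); rewrite mulrC; under eq_fun do rewrite mulrC.
Qed.

Lemma is_cderive0 t : is_cderive (fun=> 0) t 0.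
Proof. by split; exact: is_derive_cst. Qed.

Lemma is_cderive_sum (I : finType) (f : I -> R -> R[i]) t (df : I -> R[i]) :
  (forall i, is_cderive (f i) t (df i)) ->
  is_cderive (fun s => \sum_i f i s) t (\sum_i df i).
Proof.
move=> fdf; elim: (index_enum I) => [|i r IHr].
  by rewrite big_nil; under eq_fun do rewrite big_nil; exact: is_cderive0.
by rewrite big_cons; under eq_fun do rewrite big_cons; exact: is_cderiveD.
Qed.

Lemma is_cderive_real (f : R -> R) t df :
  is_derive t (1 : R) f df -> is_cderive (fun s => (f s)%:C) t df%:C.
Proof. by split=> //=; exact: is_derive_cst. Qed.

Lemma near_eq_cderiv f g t df :
  (\near t, f t = g t)%classic -> is_cderive f t df -> is_cderive g t df.
Proof.
move=> fg [fr fi]; split.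
  by apply: near_eq_is_derive fr; near do congr complex.Re.
by apply: near_eq_is_derive fi; near do congr complex.Im.
Unshelve. all: by end_near. Qed.

Lemma is_cderive_expi (k : R) : is_cderive (fun s => expi (k * s)) 0 ('i * k%:C).
Proof.
have dk : is_derive (0 : R) (1 : R) (fun s => k * s) k.
  by have := is_deriveZ k (is_derive_id (0 : R) (1 : R)); rewrite /GRing.scale /= mulr1.
split=> /=.
  apply: (is_derive_eq (is_derive1_comp (is_derive_cos _) dk)).
  by rewrite mulr0 sin0; ring.
apply: (is_derive_eq (is_derive1_comp (is_derive_sin _) dk)).
by rewrite mulr0 cos0; ring.
Qed.

Lemma is_cderive_mulmx (m n p q : nat) (P : 'M[R[i]]_(m, n)) (Q : 'M[R[i]]_(p, q))
    (F : R -> 'M[R[i]]_(n, p)) (dF : 'M[R[i]]_(n, p)) t :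
  (forall i j, is_cderive (fun s => F s i j) t (dF i j)) ->
  forall i j, is_cderive (fun s => (P *m F s *m Q) i j) t ((P *m dF *m Q) i j).
Proof.
move=> FdF i j; rewrite mxE; under eq_fun do rewrite mxE.
apply: is_cderive_sum => r; apply: is_cderiveMr.
rewrite mxE; under eq_fun do rewrite mxE.
by apply: is_cderive_sum => u; exact: is_cderiveMl.
Qed.

Lemma cmx_deriveP (p q : nat) (F : R -> 'M[R[i]]_(p, q)) (dF : 'M[R[i]]_(p, q)) t :
  (forall i j, is_cderive (fun s => F s i j) t (dF i j)) ->
  cmx_derivable F t /\ cmx_derive F t = dF.
Proof.
move=> FdF.
have coordE (h : R[i] -> R) i j :
    (fun s => map_mx h (F s) i j) = (fun s => h (F s i j)).
  by apply/funext => s; rewrite mxE.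
have dr : derivable (fun s => map_mx (@complex.Re R) (F s)) t 1.
  by apply/derivable_mxP => i j; rewrite coordE; case: (FdF i j) => [[]].
have di : derivable (fun s => map_mx (@complex.Im R) (F s)) t 1.
  by apply/derivable_mxP => i j; rewrite coordE; case: (FdF i j) => [_ []].
split=> //; apply/matrixP => i j.
rewrite mxE (derive_mx dr) (derive_mx di) !mxE !coordE.
case: (FdF i j) => Fr Fi.
by rewrite (@derive_val _ _ _ _ _ _ _ Fr) (@derive_val _ _ _ _ _ _ _ Fi); case: (dF i j).
Qed.

End ComplexDerivative.

(** * Derivatives along the three axes *)

Section HarmonicCurves.
Variables (R : realType) (l : nat).

Definition to_real_basis (W : 'M[R[i]]_(l.*2.+1)) : 'M[R[i]]_(l.*2.+1) :=
  map_mx conjc (T_mx R l) *m W *m (T_mx R l)^T.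

(** The derivative at b = 0 of [wigner_euler l a b g]. *)
Definition euler_gen (a g : R) : 'M[R[i]]_(l.*2.+1) :=
  \matrix_(i, j) (expi a ^ (- lab i) * (wigner_gen R l i j)%:C
                  * expi g ^ (- lab j)).

(** The derivative at a = 0 of [wigner_euler l a 0 0]. *)
Definition z_gen : 'M[R[i]]_(l.*2.+1) :=
  \matrix_(i, j) ('i * ((- lab i)%:~R)%:C * (i == j)%:R).

Lemma is_cderive_wigner_euler (a g : R) i j :
  is_cderive (fun s => wigner_euler l a s g i j) 0 (euler_gen a g i j).
Proof.
rewrite [euler_gen a g i j]mxE; under eq_fun do rewrite wigner_eulerE.
apply: is_cderiveMr; apply: is_cderiveMl; apply: is_cderive_real.
exact: is_derive_mexp0.
Qed.

Lemma near0_lt_pi : (\forall s \near (0 : R), `|s| < pi)%classic.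
Proof. exact: nbhs0_lt (@pi_gt0 R). Qed.

(** The one-parameter subgroup has to be written with Euler angles; the bound
    on [b] keeps them within reach of [wigner_D_euler_rot] near 0. *)
Lemma harm_curve_deriv (eta : 'cV[R]_3) (a b g : R -> R) (W : 'M[R[i]]_(l.*2.+1)) :
  (forall s, mexp (s *: hat eta) = euler_rot (a s) (b s) (g s)) ->
  (forall s, `|b s| <= `|s|) ->
  (forall i j, is_cderive (fun s => wigner_euler l (a s) (b s) (g s) i j) 0 (W i j)) ->
  cmx_derivable (harm_curve l eta) 0 /\ harm_gen l eta = to_real_basis W.
Proof.
move=> etaE bs dW; apply: cmx_deriveP => i j.
apply: near_eq_cderiv (is_cderive_mulmx (map_mx conjc (T_mx R l)) (T_mx R l)^T dW i j).
apply: filterS near0_lt_pi => s s_pi.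
rewrite /harm_curve /real_harm etaE wigner_D_euler_rot //.
exact: le_lt_trans s_pi.
Qed.

(** The quarter turn by -pi/2 about the third axis carries the second axis to
    the first, so rotations about the first axis are conjugates of rotations
    about the second one. *)
Lemma harm_curve_e1 : cmx_derivable (harm_curve l (basis_vec R 0)) 0 /\
  harm_gen l (basis_vec R 0) = to_real_basis (euler_gen (- (pi / 2)) (pi / 2)).
Proof.
apply: (@harm_curve_deriv _ (fun=> - (pi / 2)) id (fun=> pi / 2)) => // [s|i j].
  rewrite rot1E euler_rotE cosN sinN cos_pihalf sin_pihalf.
  by apply: mx3P; rewrite !mxE /=; ring.
exact: is_cderive_wigner_euler.
Qed.

Lemma harm_curve_e2 : cmx_derivable (harm_curve l (basis_vec R 1)) 0 /\
  harm_gen l (basis_vec R 1) = to_real_basis (euler_gen 0 0).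
Proof.
apply: (@harm_curve_deriv _ (fun=> 0) id (fun=> 0)) => // [s|i j].
  rewrite rot2E euler_rotE cos0 sin0.
  by apply: mx3P; rewrite !mxE /=; ring.
exact: is_cderive_wigner_euler.
Qed.

Lemma harm_curve_e3 : cmx_derivable (harm_curve l (basis_vec R 2%:R)) 0 /\
  harm_gen l (basis_vec R 2%:R) = to_real_basis z_gen.
Proof.
apply: (@harm_curve_deriv _ id (fun=> 0) (fun=> 0)) => [s|s|i j].
- rewrite rot3E euler_rotE cos0 sin0.
  by apply: mx3P; rewrite !mxE /=; ring.
- by rewrite normr0.
rewrite mxE; under eq_fun do rewrite wigner_euler_b0 addr0 -expiX.
by apply: is_cderiveMr; exact: is_cderive_expi.
Qed.

End HarmonicCurves.

(** * Passing to the real harmonics *)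

Section RealEntries.
Variables (R : realType) (l : nat).
Local Notation sq2 := (Num.sqrt (2 : R)).
Local Notation sgn := (@lab_sign R l).
Implicit Types i j p q : 'I_(l.*2.+1).

Lemma lab_rev i : lab (rev_ord i) = - lab i.
Proof. by have := ltn_ord i; rewrite /lab /=; lia. Qed.

Lemma lab_inj : injective (@lab l).
Proof. by move=> i j; rewrite /lab => /addIr [] /val_inj. Qed.

Lemma rev_ord0 i : lab i = 0 -> rev_ord i = i.
Proof. by move=> i0; apply: lab_inj; rewrite lab_rev i0 oppr0. Qed.

Lemma rev_ord_neq i : lab i != 0 -> rev_ord i != i.
Proof. by apply: contra_neq => /(congr1 (@lab l)); rewrite lab_rev => ?; lia. Qed.

Lemma lab_sign0 i : lab i = 0 -> sgn i = 1.
Proof. by rewrite /lab_sign => ->. Qed.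

Lemma lab_sign_rev i : sgn (rev_ord i) = sgn i.
Proof. by rewrite /lab_sign lab_rev -exprz_inv invrN1. Qed.

(** Row [i] of [T_mx] is supported on the labels m and -m of [i] and of
    [rev_ord i]; this is the linear form it defines. *)
Definition T_row i (f : 'I_(l.*2.+1) -> R[i]) : R[i] :=
  if lab i == 0 then f i
  else if 0 < lab i then
    (sgn i / sq2)%:C * f i + (1 / sq2)%:C * f (rev_ord i)
  else 'i * (1 / sq2)%:C * f i - 'i * (sgn i / sq2)%:C * f (rev_ord i).

Lemma T_rowE i f : \sum_p T_mx R l i p * f p = T_row i f.
Proof.
rewrite /T_row (bigD1 i) //=; have [i0|i0] := eqVneq (lab i) 0.
  rewrite mxE /= i0 eqxx /= mul1r big1 ?addr0 // => p pi.
  rewrite mxE /= i0 eqxx /=.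
  have /negPf p0 : lab p != 0 by apply: contra_neq pi => p0; apply: lab_inj; rewrite i0.
  by rewrite p0 normr0 eq_sym normr_eq0 p0 /= mul0r.
rewrite (bigD1 (rev_ord i)) ?rev_ord_neq //= big1 ?addr0 => [|p /andP[pi pri]].
  rewrite !mxE /= lab_rev (negPf i0) normrN !eqxx /=.
  have -> : (- lab i == lab i) = false by lia.
  by case: ifP => _ //; rewrite !mulNr.
rewrite mxE /= (negPf i0) /=.
suff -> : `|lab i| != `|lab p| by rewrite mul0r.
have pi' : lab p != lab i by apply: contra_neq pi => /lab_inj ->.
have pri' : lab p != - lab i by rewrite -lab_rev; apply: contra_neq pri => /lab_inj ->.
by lia.
Qed.

Lemma to_real_basisE (W : 'M[R[i]]_(l.*2.+1)) i j :
  to_real_basis W i j = T_row j (fun q => conjc (T_row i (fun p => conjc (W p q)))).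
Proof.
rewrite -T_rowE mxE; apply: eq_bigr => q _; rewrite mulrC mxE; congr (_ * _).
rewrite -T_rowE mxE rmorph_sum; apply: eq_bigr => p _.
by rewrite rmorphM /= conjcK mxE.
Qed.

(** By [conj_symmetric], the four entries of [W] at the labels (+-m, +-n)
    reduce to those at (m, n) and (m, -n), so each entry of [W] in the real
    basis is a signed combination of two real or imaginary parts. *)
Definition real_entry (W : 'M[R[i]]_(l.*2.+1)) i j : R :=
  let re p q := complex.Re (W p q) in let im p q := complex.Im (W p q) in
  if lab i == 0 then
    if lab j == 0 then re i j
    else if 0 < lab j then sq2 * (sgn j * re i j) else - (sq2 * im i j)
  else if lab j == 0 then
    if 0 < lab i then sq2 * (sgn i * re i j) else sq2 * im i j
  else if 0 < lab i then
    if 0 < lab j then sgn i * re i j * sgn j + sgn i * re i (rev_ord j)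
    else sgn i * im i (rev_ord j) * sgn j - sgn i * im i j
  else
    if 0 < lab j then sgn j * im i j + im i (rev_ord j)
    else re i j - sgn j * re i (rev_ord j).

(** It says that [W] commutes with the antilinear involution sending the
    vector f_m to (-1)^m conj(f_(-m)), which fixes every row of [T_mx]. *)
Definition conj_symmetric (W : 'M[R[i]]_(l.*2.+1)) : Prop :=
  forall i j, W (rev_ord i) (rev_ord j) = (sgn i * sgn j)%:C * conjc (W i j).

Lemma to_real_basis_real (W : 'M[R[i]]_(l.*2.+1)) i j :
  conj_symmetric W -> to_real_basis W i j = (real_entry W i j)%:C.
Proof.
move=> Wreal; rewrite to_real_basisE /real_entry /T_row.
have Wrr := Wreal i j.
have Wr : W (rev_ord i) j = (sgn i * sgn j)%:C * conjc (W i (rev_ord j)).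
  by rewrite -(lab_sign_rev j) -Wreal rev_ordK.
have si2 := lab_sign_sqr R i; have sj2 := lab_sign_sqr R j.
have r0 : sq2 != 0 by rewrite sqrtr_eq0 -ltNge ltr0n.
have q2 : sq2^-1 ^+ 2 = 2^-1 by rewrite exprVn sqr_sqrtr.
have qr : sq2 = 2 * sq2^-1 by apply: (mulIf r0); rewrite divfK // -expr2 sqr_sqrtr.
have [i0|i0] := eqVneq (lab i) 0; have [j0|j0] := eqVneq (lab j) 0.
- move: Wrr; rewrite !rev_ord0 // !lab_sign0 // mulr1 mul1r conjcK.
  by case: (W i j) => a b [] /= b0; congr Complex; lra.
- have Wr' : W i (rev_ord j) = (sgn j)%:C * conjc (W i j).
    by rewrite -[in LHS](rev_ord0 i0) Wrr lab_sign0 // mul1r.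
  rewrite Wr' div1r; move: q2 qr; move: sq2^-1 => q q2 ->.
  move: (W i j) (sgn j) sj2 => [a b] t t2.
  by case: ifP => _; apply/eqP; rewrite eq_complex /=; apply/andP; split;
    apply/eqP; ring: t2.
- have Wr' : W (rev_ord i) j = (sgn i)%:C * conjc (W i j).
    by rewrite -[in LHS](rev_ord0 j0) Wrr (lab_sign0 j0) mulr1.
  rewrite Wr' div1r; move: q2 qr; move: sq2^-1 => q q2 ->.
  move: (W i j) (sgn i) si2 => [a b] s s2.
  by case: ifP => _; apply/eqP; rewrite eq_complex /=; apply/andP; split;
    apply/eqP; ring: s2.
- rewrite Wrr Wr div1r; move: q2; move: sq2^-1 => q q2.
  move: (W i j) (W i (rev_ord j)) (sgn i) (sgn j) si2 sj2 => [a b] [c d] s t s2 t2.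
  (* q is 1 / sqrt 2, and every summand carries a factor q ^+ 2. *)
  have q22 : 2 * q ^+ 2 = 1 by rewrite q2 divff.
  by do 2 case: ifP => _; apply/eqP; rewrite eq_complex /=; apply/andP; split;
    apply/eqP; rewrite -[RHS]mul1r -[X in _ = X * _]q22; ring: s2 t2.
Qed.

End RealEntries.

(** * The generators before the change of basis *)

Section Generators.
Variables (R : realType) (l : nat).
Local Notation sgn := (@lab_sign R l).
Local Notation gen := (wigner_gen R l).
Implicit Types i j : 'I_(l.*2.+1).

Lemma conj_expi (a : R) : conjc (expi a) = (expi a)^-1.
Proof. by rewrite -expiN /expi cosN sinN. Qed.

(** Negating the label exchanges the raising and the lowering coefficients,
    which enter the generator with opposite signs. *)
Lemma wigner_gen_rev i j : gen (rev_ord i) (rev_ord j) = - gen i j.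
Proof.
rewrite !mxE /= !lab_rev opprK.
have -> : (- lab i - 1 == - lab j) = (lab i + 1 == lab j) by lia.
have -> : (- lab i + 1 == - lab j) = (lab i - 1 == lab j) by lia.
by ring.
Qed.

Lemma euler_gen_conj_symmetric a g : conj_symmetric (euler_gen l a g : 'M[R[i]]__).
Proof.
have conjX (b : R) (k : int) : conjc (expi b ^ (- k)) = expi b ^ k.
  by rewrite -[expi b in RHS]invrK -conj_expi exprz_inv fmorphXz.
have conjM (x y : R[i]) : conjc (x * y) = conjc x * conjc y by exact: rmorphM.
have realM (x y : R) : (x * y)%:C = x%:C * y%:C by exact: rmorphM.
have pull_signs (C : comPzRingType) (x s w t y : C) :
  x * (s * w * t) * y = s * t * (x * w * y) by ring.
move=> i j; rewrite [LHS]mxE [euler_gen _ _ _ i j]mxE !lab_rev !opprK.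
have -> : conjc (expi a ^ (- lab i) * (gen i j)%:C * expi g ^ (- lab j))
        = expi a ^ lab i * (gen i j)%:C * expi g ^ lab j.
  rewrite conjM conjM.
  by congr (_ * _ * _); [exact: conjX|exact: conjc_real|exact: conjX].
rewrite wigner_gen_rev -wigner_gen_sign !realM.
exact: pull_signs.
Qed.

Lemma z_gen_conj_symmetric : conj_symmetric (z_gen R l).
Proof.
move=> i j; rewrite !mxE !lab_rev (inj_eq rev_ord_inj).
case: eqVneq => [<-|_]; last by rewrite !mulr0 conjc0 mulr0.
rewrite -expr2 lab_sign_sqr mul1r !mulr1; apply/eqP.
by rewrite eq_complex /= opprK rmorphN /=; apply/andP; split; apply/eqP; ring.
Qed.

(** Up to the factor -i/2, the generator of the rotations about the first
    axis: the raising and the lowering parts with equal signs. *)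
Definition ladder_sum i j : R :=
  let m := lab i in let n := lab j in
  Num.sqrt (((l%:Z + m) * (l%:Z - m + 1))%:~R) * (m - 1 == n)%:R
  + Num.sqrt (((l%:Z - m) * (l%:Z + m + 1))%:~R) * (m + 1 == n)%:R.

Lemma euler_gen2E i j : euler_gen l 0 0 i j = (gen i j)%:C.
Proof. by rewrite [LHS]mxE expi0 !exp1rz mul1r mulr1. Qed.

(** The phases at (-pi/2, pi/2) multiply the entry (m, n) by i^(m-n), which is
    i on the lowering part m - n = 1 and -i on the raising part. *)
Lemma euler_gen1E i j : euler_gen l (- (pi / 2)) (pi / 2) i j
  = 0 +i* (- (1 / 2) * ladder_sum i j).
Proof.
have ei : expi (pi / 2) = 'i%C :> R[i] by rewrite /expi cos_pihalf sin_pihalf.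
have eNi : (expi (pi / 2))^-1 = 0 +i* (-1) :> R[i].
  by rewrite -expiN /expi cosN sinN cos_pihalf sin_pihalf.
rewrite [LHS]mxE expiN exprz_inv opprK mulrAC -expfzDr ?expi_neq0 //.
rewrite mxE /ladder_sum /=.
have [ij|_] := eqVneq (lab i - 1) (lab j).
  have -> : (lab i + 1 == lab j) = false by lia.
  have -> : lab i - lab j = 1 by lia.
  by apply/eqP; rewrite expr1z ei eq_complex /=; apply/andP; split; apply/eqP; ring.
have [ij|_] := eqVneq (lab i + 1) (lab j); last first.
  by rewrite !mulr0 addr0 mulr0 mulr0.
have -> : lab i - lab j = - 1 by lia.
rewrite -exprz_inv expr1z eNi.
by apply/eqP; rewrite eq_complex /=; apply/andP; split; apply/eqP; ring.
Qed.

Lemma z_genE i j :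
  z_gen R l i j = 0 +i* ((- lab i)%:~R * (lab i == lab j)%:R).
Proof.
have ik (k : R) : 'i * k%:C = 0 +i* k.
  apply/eqP; rewrite eq_complex; apply/andP; split; apply/eqP => /=; ring.
rewrite mxE ik (inj_eq (@lab_inj l)).
by case: (i == j); rewrite ?mulr1 ?mulr0.
Qed.

Lemma lab_sign_adj i j :
  (lab i - 1 == lab j) || (lab i + 1 == lab j) -> sgn i * sgn j = - 1.
Proof.
have sq := @lab_sign_sqr R l; case/orP=> /eqP ij.
  by rewrite (@lab_sign_add1 R l i j) ?mulNr -?expr2 ?sq //; lia.
by rewrite (@lab_sign_add1 R l j i) ?mulrN -?expr2 ?sq //; lia.
Qed.

Lemma lab_sign_opp i j : lab i == - lab j -> sgn i * sgn j = 1.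
Proof.
by rewrite -lab_rev => /eqP/lab_inj ->; rewrite lab_sign_rev -expr2 lab_sign_sqr.
Qed.

End Generators.

(** * Entries in the real basis *)

Section Tables.
Variables (R : realType) (l : nat).
Local Notation sq2 := (Num.sqrt (2 : R)).
Implicit Types i j : 'I_(l.*2.+1).

Lemma lab_range i : - l%:Z <= lab i <= l%:Z.
Proof. by have := ltn_ord i; rewrite /lab; lia. Qed.

Lemma sqrt2E : sq2 = 2 * sq2^-1.
Proof.
have r0 : sq2 != 0 by rewrite sqrtr_eq0 -ltNge ltr0n.
by apply: (mulIf r0); rewrite divfK // -expr2 sqr_sqrtr.
Qed.

(** Once the signs of m and n are fixed, linear arithmetic decides most tests
    of a table; the others are genuine case splits. *)
Ltac decide_condition b :=
  lazymatch b with
  | true => fail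
  | false => fail
  | _ => first [ have -> : b = true by lia | have -> : b = false by lia
               | case: (boolP b) => ? ]
  end.

Ltac decide_conditions :=
  repeat (match goal with
  | |- context [if ?b then _ else _] => decide_condition b
  | |- context [nat_of_bool ?b] => decide_condition b
  end; cbv beta iota).

Lemma lower_sqrt (m : int) : (m == 0) || (m == 1) ->
  Num.sqrt (((l%:Z + m) * (l%:Z - m + 1))%:~R) = Num.sqrt ((l * (l + 1))%:R) :> R.
Proof.
by case/orP=> /eqP ->; rewrite ?addr0 ?subr0 ?subrK ?[(_ + 1) * _]mulrC.
Qed.

Lemma raise_sqrt (m : int) : (m == 0) || (m == - 1) ->
  Num.sqrt (((l%:Z - m) * (l%:Z + m + 1))%:~R) = Num.sqrt ((l * (l + 1))%:R) :> R.
Proof.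
by case/orP=> /eqP ->; rewrite ?opprK ?addr0 ?subr0 ?subrK ?[(_ + 1) * _]mulrC.
Qed.

(** [st] is the parity relation between the two labels, whose premise holds
    on every cell where a Kronecker delta survives; when one label is 0, [s0]
    and [t0] turn it into the sign of the other label. *)
Ltac solve_entry m m0 n0 s0 t0 st :=
  rewrite ?mulr1 ?mulr0 ?addr0 ?add0r;
  try rewrite (gtr0_norm m0); try rewrite (ltr0_norm m0) ?opprK;
  try rewrite (@lower_sqrt m ltac:(lia)); try rewrite (@raise_sqrt m ltac:(lia));
  let e := fresh in
  try have e := st ltac:(lia);
  try rewrite (t0 n0) in e |- *; try rewrite (s0 m0) in e |- *;
  try rewrite (t0 n0); try rewrite (s0 m0);
  rewrite ?mulr1 ?mul1r; first [ring | by field | ring: e | by field: e].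

(** The generator is real, so [real_entry] only sees real parts; they vanish
    unless m and n differ by 1, and then lie on the same side of 0 or one of
    them is 0. *)
Lemma real_entry_e2 i j : let m := lab i in let n := lab j in
  real_entry (euler_gen l (0 : R) 0) i j =
          (if (2 <= m) && (n == m - 1) || (m <= - 2) && (n == m + 1) then
             1 / 2 * Num.sqrt (((l%:Z + `|m|) * (l%:Z - `|m| + 1))%:~R)
           else if (1 <= m <= l%:Z - 1) && (n == m + 1)
                   || (- l%:Z + 1 <= m <= - 1) && (n == m - 1) then
             - (1 / 2) * Num.sqrt (((l%:Z - `|m|) * (l%:Z + `|m| + 1))%:~R)
           else if (m == 1) && (n == 0) then
             1 / Num.sqrt 2 * Num.sqrt ((l * (l + 1))%:R)
           else if (m == 0) && (n == 1) then
             - (1 / Num.sqrt 2) * Num.sqrt ((l * (l + 1))%:R)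
           else 0).
Proof.
move=> m n.
rewrite /real_entry !euler_gen2E /= !mxE /=.
have := @lab_sign_adj R l i j; have := @lab_sign0 R l i; have := @lab_sign0 R l j.
rewrite ?lab_sign_rev ?lab_rev -/m -/n.
have := lab_range i; have := lab_range j; rewrite -/m -/n.
move: m n (lab_sign R i) (lab_sign R j) => m n s t nl ml t0 s0 st.
rewrite ?div1r; have := sqrt2E; move: (sq2^-1) => q ->.
have [m0|m0|m0] := ltgtP m 0; have [n0|n0|n0] := ltgtP n 0.
all: decide_conditions.
all: solve_entry m m0 n0 s0 t0 st.
Qed.

(** The generator is purely imaginary, so [real_entry] only sees imaginary
    parts: this moves the entries from n = m +- 1 to n = -m +- 1, where the
    relevant parity is that of the labels m and -n. *)
Lemma real_entry_e1 i j : let m := lab i in let n := lab j in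
  real_entry (euler_gen l (- (pi / 2) : R) (pi / 2)) i j =
          (if (2 <= m) && (n == - m + 1) || (m <= - 2) && (n == - m - 1) then
             1 / 2 * (m + n)%:~R
               * Num.sqrt (((l%:Z + `|m|) * (l%:Z - `|m| + 1))%:~R)
           else if (1 <= m <= l%:Z - 1) && (n == - m - 1)
                   || (- l%:Z + 1 <= m <= - 1) && (n == - m + 1) then
             - (1 / 2) * (m + n)%:~R
               * Num.sqrt (((l%:Z - `|m|) * (l%:Z + `|m| + 1))%:~R)
           else if (m == - 1) && (n == 0) then
             - (1 / Num.sqrt 2) * Num.sqrt ((l * (l + 1))%:R)
           else if (m == 0) && (n == - 1) then
             1 / Num.sqrt 2 * Num.sqrt ((l * (l + 1))%:R)
           else 0).
Proof.
move=> m n.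
rewrite /real_entry !euler_gen1E /ladder_sum /=.
have := @lab_sign_adj R l i (rev_ord j); have := @lab_sign0 R l i; have := @lab_sign0 R l j.
rewrite ?lab_sign_rev ?lab_rev -/m -/n.
have := lab_range i; have := lab_range j; rewrite -/m -/n.
move: m n (lab_sign R i) (lab_sign R j) => m n s t nl ml t0 s0 st.
rewrite ?div1r; have := sqrt2E; move: (sq2^-1) => q ->.
have [m0|m0|m0] := ltgtP m 0; have [n0|n0|n0] := ltgtP n 0.
all: decide_conditions.
all: try have -> : m + n = 1 by lia.
all: try have -> : m + n = - 1 by lia.
all: rewrite ?rmorphN1.
all: solve_entry m m0 n0 s0 t0 st.
Qed.

(** As for the first axis, the diagonal moves to n = -m. *)
Lemma real_entry_e3 i j : let m := lab i in let n := lab j in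
  real_entry (z_gen R l) i j =
    (if (m == - n) && (m != 0) then (- m)%:~R else 0).
Proof.
move=> m n.
rewrite /real_entry !z_genE /=.
have := @lab_sign_opp R l i j; have := @lab_sign0 R l i; have := @lab_sign0 R l j.
rewrite ?lab_sign_rev ?lab_rev -/m -/n.
have := lab_range i; have := lab_range j; rewrite -/m -/n.
move: m n (lab_sign R i) (lab_sign R j) => m n s t nl ml t0 s0 st.
rewrite ?div1r; have := sqrt2E; move: (sq2^-1) => q ->.
have [m0|m0|m0] := ltgtP m 0; have [n0|n0|n0] := ltgtP n 0.
all: decide_conditions.
all: solve_entry m m0 n0 s0 t0 st.
Qed.

End Tables.

Theorem theorem3 (R : realType) (l : nat) :
  (forall k : 'I_3, cmx_derivable (harm_curve l (basis_vec R k)) 0) /\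
  (forall i j : 'I_(l.*2.+1),
    let m := lab i in
    let n := lab j in
    [/\ harm_gen l (basis_vec R 0) i j =
          (if (2 <= m) && (n == - m + 1) || (m <= - 2) && (n == - m - 1) then
             1 / 2 * (m + n)%:~R
               * Num.sqrt (((l%:Z + `|m|) * (l%:Z - `|m| + 1))%:~R)
           else if (1 <= m <= l%:Z - 1) && (n == - m - 1)
                   || (- l%:Z + 1 <= m <= - 1) && (n == - m + 1) then
             - (1 / 2) * (m + n)%:~R
               * Num.sqrt (((l%:Z - `|m|) * (l%:Z + `|m| + 1))%:~R)
           else if (m == - 1) && (n == 0) then
             - (1 / Num.sqrt 2) * Num.sqrt ((l * (l + 1))%:R)
           else if (m == 0) && (n == - 1) then
             1 / Num.sqrt 2 * Num.sqrt ((l * (l + 1))%:R)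
           else 0)%:C,
        harm_gen l (basis_vec R 1) i j =
          (if (2 <= m) && (n == m - 1) || (m <= - 2) && (n == m + 1) then
             1 / 2 * Num.sqrt (((l%:Z + `|m|) * (l%:Z - `|m| + 1))%:~R)
           else if (1 <= m <= l%:Z - 1) && (n == m + 1)
                   || (- l%:Z + 1 <= m <= - 1) && (n == m - 1) then
             - (1 / 2) * Num.sqrt (((l%:Z - `|m|) * (l%:Z + `|m| + 1))%:~R)
           else if (m == 1) && (n == 0) then
             1 / Num.sqrt 2 * Num.sqrt ((l * (l + 1))%:R)
           else if (m == 0) && (n == 1) then
             - (1 / Num.sqrt 2) * Num.sqrt ((l * (l + 1))%:R)
           else 0)%:C
      & harm_gen l (basis_vec R 2%:R) i j =
          (if (m == - n) && (m != 0) then (- m)%:~R else 0)%:C ]).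
Proof.
split=> [k|i j m n].
  case: (ord3P k) => ->.
  - exact: (harm_curve_e1 R l).1.
  - exact: (harm_curve_e2 R l).1.
  - exact: (harm_curve_e3 R l).1.
split.
- rewrite (harm_curve_e1 R l).2 to_real_basis_real ?real_entry_e1 //.
  exact: euler_gen_conj_symmetric.
- rewrite (harm_curve_e2 R l).2 to_real_basis_real ?real_entry_e2 //.
  exact: euler_gen_conj_symmetric.
- rewrite (harm_curve_e3 R l).2 to_real_basis_real ?real_entry_e3 //.
  exact: z_gen_conj_symmetric.
Qed.
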